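(* Let $s,k,d \in \mathbb{Z}_{>0}$ with $\gcd(s,k)=1$ and $s \ge 2$, and let $b \ge 2$ and $0\le c<b$ be integers. For positive integers $S,K,D$, let $H_D(S,K)$ denote the maximum possible hook length of a cell in the Young diagram of an $(S,S+K)$-core with $D$-distinct parts. Let $\overline{s} = s \bmod k$ and $\widetilde{s} = \min \{\ell \cdot (\overline{s})^{-1} \bmod k \mid -d \leq \ell \leq d,\ \ell\neq0\}$, where $(\overline{s})^{-1}$ is the inverse of $\overline{s}$ modulo $k$. Then \[ H_{bd+c}(bs,bk)=\begin{cases} b\left(H_{d}(s,k)+2\right)-1 &\text{if } k=1 \text{ and } d<s,\\ b\left(H_{d}(s,k)+1\right)-1 &\text{if } k=1 \text{ and } d\geq s, \\ b\left(H_{d}(s,k)+2\right)-1 &\text{if } d < k \text{ and } \big(\overline{s}\widetilde{s}\bmod k = 1 \text{ or } d < \overline{s} \widetilde{s} \bmod k = k-1\big), \\ b\left(H_{d}(s,k)+1\right)-1 &\text{if } k > 1 \text{ and } \big(1 < \overline{s} \widetilde{s} \bmod k \le d \text{ or } d < \overline{s} \widetilde{s} \bmod k < k-1 \text{ or } d\geq k\big). \end{cases} \]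
   Context: A partition is a weakly decreasing tuple of positive integers $\lambda=(\lambda_1,\dots,\lambda_n)$; its Young diagram is the left-justified array with $\lambda_i$ cells in row $i$. The hook of a cell consists of the cell itself, all cells to its right in its row, and all cells below it in its column; the hook length is the number of cells in the hook. An $(S,T)$-core is a partition whose Young diagram has no cell of hook length $S$ or $T$. A partition is $D$-distinct (has $D$-distinct parts) if $\lambda_i-\lambda_{i+1}\ge D$ for all $i\in[n-1]$. Here $a \bmod b$ denotes the remainder of Euclidean division of $a$ by $b$. *)

(* Defs.v *)
From mathcomp Require Import all_boot all_order all_algebra.
From mathcomp Require Import zify.

Set Implicit Arguments.
Unset Strict Implicit.
Unset Printing Implicit Defensive.

Definition is_partition (la : seq nat) : bool :=
  sorted geq la && (0 \notin la).

(* Cells are pairs (row, column), both counted from 0. *)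
Definition young (la : seq nat) : seq (nat * nat) :=
  [seq (i, j) | i <- iota 0 (size la), j <- iota 0 (nth 0 la i)].

Definition in_hook (u v : nat * nat) : bool :=
  ((v.1 == u.1) && (u.2 <= v.2)) || ((v.2 == u.2) && (u.1 <= v.1)).

Definition hook_length (la : seq nat) (u : nat * nat) : nat :=
  count (in_hook u) (young la).

Definition is_core2 (S T : nat) (la : seq nat) : Prop :=
  is_partition la /\
  forall u, u \in young la -> hook_length la u <> S /\ hook_length la u <> T.

Definition distinct_parts (D : nat) (la : seq nat) : Prop :=
  forall i, i.+1 < size la -> nth 0 la i.+1 + D <= nth 0 la i.

Definition occurs_as_hook (D S K h : nat) : Prop :=
  exists (la : seq nat) (u : nat * nat),
    [/\ is_core2 S (S + K) la, distinct_parts D la,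
        u \in young la & hook_length la u = h].

(* [is_max_hook D S K h] says that the maximum H_D(S, K) exists and equals h. *)
Definition is_max_hook (D S K h : nat) : Prop :=
  occurs_as_hook D S K h /\
  forall h', occurs_as_hook D S K h' -> h' <= h.

(* The residue t in [0, k) with a * t = 1 modulo k; see [inv_modP]. *)
Definition inv_mod (a k : nat) : nat :=
  find (fun t => a * t == 1 %[mod k]) (iota 0 k).

(* The index i stands for l = i - d, so l runs over the nonzero integers in
   [-d, d]. All the residues are below k, so the default k is never the
   minimum; see [s_tildeP]. *)
Definition s_tilde (s k d : nat) : nat :=
  \big[minn/k]_(i < (2 * d).+1 | (i : nat) != d)
    absz (((i%:Z - d%:Z) * (inv_mod (s %% k) k)%:Z)%R %% k%:Z)%Z.

Lemma max_hook_unique D S K h1 h2 :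
  is_max_hook D S K h1 -> is_max_hook D S K h2 -> h1 = h2.
Proof.
move=> [o1 m1] [o2 m2]; apply/eqP.
by rewrite eqn_leq m2 // m1.
Qed.

Lemma inv_modP a k : 0 < k -> coprime a k ->
  inv_mod a k < k /\ a * inv_mod a k = 1 %[mod k].
Proof.
move=> k0 cak.
have hs : has (fun t => a * t == 1 %[mod k]) (iota 0 k).
  have [a0|a0] := posnP a.
    move: cak; rewrite a0 /coprime gcd0n => /eqP ->.
    by apply/hasP; exists 0; rewrite ?modn1.
  case: (egcdnP k a0) => u v e _; move: e; rewrite (eqP cak) => e.
  apply/hasP; exists (u %% k); first by rewrite mem_iota /= ltn_mod.
  by rewrite modnMmr mulnC e modnMDl.
have lt : inv_mod a k < k by rewrite -[X in _ < X](size_iota 0) -has_find.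
split=> //; have := nth_find 0 hs; rewrite -/(inv_mod a k) nth_iota //.
by move/eqP.
Qed.

Lemma s_tildeP (s k d : nat) : 0 < k -> 0 < d ->
  let r (l : int) := ((l * (inv_mod (s %% k) k)%:Z)%R %% k%:Z)%Z in
  (exists l : int, [/\ l != 0, - d%:Z <= l, l <= d%:Z
                     & r l = (s_tilde s k d)%:Z])%R /\
  (forall l : int, l != 0 -> - d%:Z <= l -> l <= d%:Z
                     -> (s_tilde s k d)%:Z <= r l)%R.
Proof.
move=> k0 d0 r.
have rb l : (0 <= r l < k%:Z)%R.
  by rewrite /r modz_ge0 ?ltz_pmod //; lia.
have le (l : int) : (l != 0 -> - d%:Z <= l -> l <= d%:Z ->
    (s_tilde s k d)%:Z <= r l)%R.
  move=> l0 l1 l2.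
  have hi : absz (l + d%:Z)%R < (2 * d).+1 by lia.
  have hn : (Ordinal hi : nat) != d by rewrite /=; lia.
  have : s_tilde s k d <= absz (r ((absz (l + d%:Z)%R)%:Z - d%:Z)%R).
    rewrite /s_tilde.
    have : Ordinal hi \in index_enum 'I_(2 * d).+1 by rewrite mem_index_enum.
    elim: (index_enum _) => // a e IH; rewrite inE big_cons.
    case/orP=> [/eqP <-|/IH H]; first by rewrite hn geq_minl.
    by case: ifP => // _; apply: leq_trans (geq_minr _ _) H.
  have -> : ((absz (l + d%:Z)%R)%:Z - d%:Z)%R = l by lia.
  by have := rb l; lia.
split=> //.
have : s_tilde s k d = k \/ exists l : int, [/\ l != 0, - d%:Z <= l, l <= d%:Z
      & r l = (s_tilde s k d)%:Z]%R.
  rewrite /s_tilde; elim/big_rec: _ => [|i x hi IH]; first by left.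
  rewrite /minn; case: ifP => _ //; right.
  exists (i%:Z - d%:Z)%R; have := ltn_ord i.
  by move=> li; split; [lia|lia|lia|have := rb (i%:Z - d%:Z)%R; rewrite /r; lia].
case=> // e; have := @le 1%R isT; have := rb 1%R; rewrite e; lia.
Qed.

(* Main.v *)
(** A partition is determined by its set [X] of first-column hook lengths, and
    its other hook lengths are the [x - y] with [x] in [X], [y < x] not in [X].
    Hence [h] is the largest hook length of a [D]-distinct [(S, S + K)]-core
    iff [h] is not in the semigroup [<S, S + K>] and the elements of that
    semigroup up to [h] are pairwise more than [D] apart.

    Let [M] be the least element of [<s, s + k>] at distance at most [d] from a
    smaller one. Then [H_{bd+c}(bs, bk) = b M - 1], whereas [H_d(s, k)] is
    [M - 1] or [M - 2], according to whether [M - 1] is outside or inside the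
    semigroup. When [d < k], put [t] for [s_tilde] and write [t s = u k + x]
    with [0 < x < k]: two elements [m s + j k] at distance at most [d] have
    values of [m] at least [t] apart, so that [M = (u + t) s] if [x <= d] and
    [M = (u + 1) (s + k)] otherwise; the gap below [M] is [x], respectively
    [k - x]. *)

Require Import Defs.
From mathcomp Require Import all_boot all_order all_algebra.
From mathcomp Require Import zify.

Set Implicit Arguments.
Unset Strict Implicit.
Unset Printing Implicit Defensive.

(** * Hook lengths and first-column hook lengths of a partition *)

Lemma nth_partition_le la i j :
  is_partition la -> i <= j -> nth 0 la j <= nth 0 la i.
Proof.
case/andP=> srt _ ij; have [jn|] := ltnP j (size la); last by move/(nth_default 0)->.
have tr : transitive geq by move=> x y z /= yx xz; apply: leq_trans xz yx.
exact: (sorted_leq_nth tr (fun x => leqnn x) 0 srt) (leq_ltn_trans ij jn) jn ij.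
Qed.

Lemma nth_partition_gt0 la i : is_partition la -> i < size la -> 0 < nth 0 la i.
Proof.
case/andP=> _ n0 ilt; rewrite lt0n; apply: contra n0 => /eqP <-.
exact: mem_nth.
Qed.

Lemma mem_young la i j : ((i, j) \in young la) = (i < size la) && (j < nth 0 la i).
Proof.
apply/allpairsPdep/andP => [[x [y [hx hy [-> ->]]]]|[hi hj]].
  by move: hx hy; rewrite !mem_iota.
by exists i, j; rewrite !mem_iota.
Qed.

Lemma count_leq_iota j m : count (leq j) (iota 0 m) = m - j.
Proof. by elim: m => // m IH; rewrite -addn1 iotaD count_cat IH /=; lia. Qed.

(* [c] is the length of column [j]. *)
Lemma hook_lengthE la i j c : i < c -> c <= size la ->
    (forall r, r < size la -> (j < nth 0 la r) = (r < c)) ->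
  hook_length la (i, j) = (nth 0 la i - j) + (c - i.+1).
Proof.
move=> ic cn colj; rewrite /hook_length /young count_flatten -map_comp sumnE.
rewrite big_map.
(* [F r] counts the hook cells in row [r]: the arm with its corner for [r = i], one leg cell for
   [i < r < c], none otherwise. *)
pose F (r : nat) : nat := if r == i then nth 0 la i - j else (i < r < c : nat).
have rowE r : r < size la ->
    count (in_hook (i, j)) [seq (r, y) | y <- iota 0 (nth 0 la r)] = F r.
  move=> rn; rewrite count_map /F; case: eqP => [->|/eqP ri].
    rewrite -count_leq_iota; apply: eq_count => y.
    by rewrite /in_hook /= eqxx; lia.
  have [ir|ir] := ltnP i r.
    transitivity (count_mem j (iota 0 (nth 0 la r))); last first.
      by rewrite count_uniq_mem ?iota_uniq // mem_iota /= colj //; lia.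
    by apply: eq_count => y; rewrite /in_hook /=; lia.
  transitivity (count pred0 (iota 0 (nth 0 la r))); last by rewrite count_pred0.
  by apply: eq_count => y; rewrite /in_hook /=; lia.
rewrite (eq_big_seq F) => [|r]; last by rewrite mem_iota => /rowE.
have : forall n, \sum_(r <- iota 0 n) F r =
    (if i < n then nth 0 la i - j else 0) + (minn n c - i.+1).
  elim=> [|n IH]; first by rewrite big_nil min0n.
  rewrite -addn1 iotaD big_cat /= big_seq1 IH /F add0n.
  by case: eqP; case: ifP; case: ifP; lia.
by move->; case: ifP; lia.
Qed.

Lemma column_length la j : is_partition la ->
  exists2 c, c <= size la & forall r, r < size la -> (j < nth 0 la r) = (r < c).
Proof.
move=> pla; exists (find (fun p => p <= j) la); first exact: find_size.
move=> r rn; apply/idP/idP => [jr|rc]; last first.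
  by rewrite ltnNge (before_find 0 rc).
rewrite ltnNge; apply/negP => cr.
have h : has (fun p => p <= j) la by rewrite has_find; lia.
by have := nth_find 0 h; have := nth_partition_le pla cr; lia.
Qed.

(* The hook length of the [i]-th cell of the first column. *)
Definition beta (la : seq nat) (i : nat) : nat := nth 0 la i + (size la - i.+1).

Lemma beta_lt la i j : is_partition la -> i < j -> j < size la ->
  beta la j < beta la i.
Proof.
by move=> pla ij jn; have := nth_partition_le pla (ltnW ij); rewrite /beta; lia.
Qed.

(** The witness [size la - c + j] encodes column [j], of length [c]: [beta la r] lies above it for
    [r < c] and below it for the remaining rows. *)
Lemma hook_length_beta la i j : is_partition la -> (i, j) \in young la ->
  exists y, [/\ beta la i = hook_length la (i, j) + y &
                forall r, r < size la -> beta la r != y].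
Proof.
move=> pla; rewrite mem_young => /andP [ilt jlt].
have [c cn colj] := column_length j pla.
have ic : i < c by rewrite -colj.
exists (size la - c + j); rewrite (hook_lengthE ic cn colj) /beta; split; first lia.
by move=> r rn; have := colj _ rn; lia.
Qed.

(* The column is found by counting the values [beta la r] above [y]. *)
Lemma beta_hook_length la i y : is_partition la -> i < size la -> y < beta la i ->
    (forall r, r < size la -> beta la r != y) ->
  exists j, (i, j) \in young la /\ hook_length la (i, j) = beta la i - y.
Proof.
move=> pla ilt yi ny.
have [c [cn cP]] : exists c, c <= size la /\
    forall r, r < size la -> (y < beta la r) = (r < c).
  exists (find (fun r => beta la r <= y) (iota 0 (size la))).
  have fs := find_size (fun r => beta la r <= y) (iota 0 (size la)).
  rewrite size_iota in fs; split=> // r rn; apply/idP/idP => [yr|rc].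
    rewrite ltnNge leq_eqVlt; apply/negP => h.
    have hs : has (fun r => beta la r <= y) (iota 0 (size la)).
      by rewrite has_find size_iota; lia.
    have := nth_find 0 hs; rewrite nth_iota ?add0n; last by lia.
    case/orP: h => [/eqP->|h]; first by lia.
    by have := beta_lt pla h rn; lia.
  by have := before_find 0 rc; rewrite nth_iota //= add0n; lia.
have ic : i < c by rewrite -cP.
have c0 : y < beta la c.-1 by rewrite cP; lia.
have c1 : c < size la -> nth 0 la c + (size la - c) <= y.
  by move=> h; have := cP c h; have := ny c h; rewrite /beta; lia.
have cy : size la - c <= y by have [/c1|] := ltnP c (size la); lia.
(* The column is obtained by solving [y = size la - c + j] for [j]. *)
have colj r : r < size la -> (y - (size la - c) < nth 0 la r) = (r < c).
  move=> rn; have [rc|rc] := ltnP r c.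
    have := @nth_partition_le la r c.-1 pla; move: c0; rewrite /beta; lia.
  have := nth_partition_le pla rc; have := c1; lia.
exists (y - (size la - c)); rewrite mem_young ilt colj // (hook_lengthE ic cn colj).
by split=> //; have := colj _ ilt; rewrite /beta; lia.
Qed.

(** * The numerical semigroup and a decision procedure for it *)

(* The numerical semigroup generated by [s] and [s + k]. *)
Definition semig (s k g : nat) : Prop := exists m j, j <= m /\ g = m * s + j * k.

Lemma semig0 s k : semig s k 0. Proof. by exists 0, 0. Qed.

Lemma semigDl s k g : semig s k g -> semig s k (g + s).
Proof. by case=> m [j [jm ->]]; exists m.+1, j; split; [lia|rewrite mulSn; lia]. Qed.

Lemma semigDr s k g : semig s k g -> semig s k (g + (s + k)).
Proof.
by case=> m [j [jm ->]]; exists m.+1, j.+1; split; [lia|rewrite !mulSn; lia].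
Qed.

(** A boolean form, needed to filter a list. For [0 < s] the bounds lose nothing, since
    [j <= m <= m * s <= g]. *)
Definition semigb (s k g : nat) : bool :=
  [exists m : 'I_g.+1, exists j : 'I_g.+1, (j <= m) && (g == m * s + j * k)].

Lemma semigP s k g : 0 < s -> reflect (semig s k g) (semigb s k g).
Proof.
move=> s0; apply: (iffP existsP) => [[m /existsP [j /andP [jm /eqP e]]]|].
  by exists m, j.
case=> m [j [jm e]]; have mg : m < g.+1 by nia.
have jg : j < g.+1 by lia.
by exists (Ordinal mg); apply/existsP; exists (Ordinal jg); rewrite /= jm e eqxx.
Qed.

(** * Hook lengths of cores against admissible numbers *)

(* [h] is the largest first-column hook length of a [D]-distinct
   [(S, S + K)]-core: the set of first-column hook lengths contains
   [h - g] for every [g <= h] in the semigroup, and it never contains [0]. *)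
Definition admissible (D S K h : nat) : Prop :=
  ~ semig S K h /\
  forall g g', semig S K g -> semig S K g' -> g' < g -> g <= h -> g' + D < g.

(** Take for [h0] the largest first-column hook length. Without hooks of length [S] or [S + K],
    subtracting either number from a first-column hook length yields another one; all of these are
    positive, and distinct parts keep them more than [D] apart. *)
Lemma occurs_admissible D S K h :
  occurs_as_hook D S K h -> exists2 h0, h <= h0 & admissible D S K h0.
Proof.
case=> la [[i j] [[pla core] dla ula hu]].
have n0 : 0 < size la by move: ula; rewrite mem_young; lia.
have bpos r : r < size la -> 0 < beta la r.
  by move=> rn; have := nth_partition_gt0 pla rn; rewrite /beta; lia.
have sep r r' : r < r' -> r' < size la -> beta la r' + D < beta la r.
  move=> rr rn; have := dla r; have := nth_partition_le pla rr; rewrite /beta; lia.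
exists (beta la 0).
  have [y [e _]] := hook_length_beta pla ula.
  have ilt : i < size la by move: ula; rewrite mem_young => /andP [].
  have [i0|i0] := posnP i; first by rewrite -i0 e hu leq_addr.
  by have := sep _ _ i0 ilt; rewrite e hu; lia.
have step T r : T = S \/ T = S + K -> r < size la -> T <= beta la r ->
    exists2 r', r' < size la & beta la r' + T = beta la r.
  move=> hT rn Tr; have [T0|T0] := posnP T; first by exists r => //; lia.
  case: (boolP (has (fun q => beta la q == beta la r - T) (iota 0 (size la)))).
    by case/hasP=> q; rewrite mem_iota => qn /eqP e; exists q; lia.
  move/hasPn => nh.
  have [|q qn|c [cy ch]] := @beta_hook_length la r (beta la r - T) pla rn.
  - by have := bpos _ rn; lia.
  - by apply: nh; rewrite mem_iota.
  by have := core _ cy; rewrite ch; lia.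
have closed g : semig S K g -> g <= beta la 0 ->
    exists2 r, r < size la & beta la r + g = beta la 0.
  case=> m [c [cm ->]].
  (* Written as a sum of generators, the element is subtracted from [beta la 0] one generator at a
     time. *)
  have -> : m * S + c * K = (m - c) * S + c * (S + K).
    by rewrite -{1}(subnK cm) mulnDl mulnDr; lia.
  elim: c m {cm} => [|c IH] m.
    rewrite subn0 mul0n addn0; elim: m => [|m IH] le; first by exists 0; lia.
    have [|r rn e] := IH; first by rewrite mulSn in le; lia.
    have [||r' rn' e'] := step S r _ rn; first by left.
      by rewrite mulSn in le; lia.
    by exists r' => //; rewrite mulSn; lia.
  have em : m.-1 - c = m - c.+1 by lia.
  rewrite mulSn -em => le; have [|r rn e] := IH m.-1; first by lia.
  have [||r' rn' e'] := step (S + K) r _ rn; first by right.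
    by lia.
  by exists r' => //; lia.
split=> [h0|g g' hg hg' gg gh].
  by have [r rn e] := closed _ h0 (leqnn _); have := bpos _ rn; lia.
have [r rn e] := closed _ hg gh.
have [|r' rn' e'] := closed _ hg'; first by lia.
have [rr|rr|rr] := ltngtP r r'; last by rewrite rr in e; lia.
  by have := sep _ _ rr rn'; lia.
by have := sep _ _ rr rn; lia.
Qed.

(** The core is built from the decreasing list [X] of all [h - g], used as first-column hook
    lengths. A hook of length [T] in a row with value [x] needs [x - T] outside [X], but for [T = S]
    or [T = S + K] the semigroup contains [(h - x) + T]. *)
Lemma admissible_occurs D S K h :
  0 < S -> admissible D S K h -> occurs_as_hook D S K h.
Proof.
move=> S0 [nh sep].
have gt_trans : transitive gtn by move=> x y z /= xy zx; apply: ltn_trans zx xy.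
have [X [sX memX inX]] : exists X : seq nat, [/\ sorted gtn X,
    forall y, y \in X -> [/\ y <= h, 0 < y & semig S K (h - y)] &
    forall y, y <= h -> semig S K (h - y) -> y \in X].
  exists [seq y <- rev (iota 0 h.+1) | semigb S K (h - y)].
  split=> [|y|y yh /(semigP _ _ S0) sy].
  - by apply: (sorted_filter gt_trans); rewrite rev_sorted iota_ltn_sorted.
  - rewrite mem_filter mem_rev mem_iota => /andP [/(semigP _ _ S0) sy yh].
    (* The value [y = 0] would put [h] itself in the semigroup. *)
    by split=> //; case: y sy {yh} => //; rewrite subn0.
  - by rewrite mem_filter sy mem_rev mem_iota; lia.
have [n szX] : exists n, size X = n by exists (size X).
have gap r r' : r < r' -> r' < n -> nth 0 X r' + D < nth 0 X r.
  move=> rr rn; have [rn0' rn'] : r < size X /\ r' < size X by lia.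
  have lt : nth 0 X r' < nth 0 X r := sorted_ltn_nth gt_trans 0 sX _ _ rn0' rn' rr.
  have [a1 a2 a3] := memX (nth 0 X r) (mem_nth 0 rn0').
  have [b1 b2 b3] := memX (nth 0 X r') (mem_nth 0 rn').
  by have := sep _ _ b3 a3; lia.
have low e i : i + e < n -> e < nth 0 X i.
  elim: e i => [|e IH] i ie.
    have ilt : i < size X by lia.
    by have [] := memX (nth 0 X i) (mem_nth 0 ilt).
  have := IH i.+1; have := @gap i i.+1; lia.
have lowX i : i < n -> n - i.+1 < nth 0 X i by move=> ilt; apply: low; lia.
pose la := mkseq (fun i => nth 0 X i - (n - i.+1)) n.
have szla : size la = n by rewrite size_mkseq.
have laE i : i < n -> nth 0 la i = nth 0 X i - (n - i.+1).
  by move=> ilt; rewrite nth_mkseq.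
have betaE i : i < n -> beta la i = nth 0 X i.
  by move=> ilt; rewrite /beta laE // szla; have := lowX _ ilt; lia.
have dla : distinct_parts D la.
  move=> i; rewrite szla => ilt; rewrite !laE //; last by lia.
  by have := @gap i i.+1; have := lowX _ ilt; lia.
have pla : is_partition la.
  apply/andP; split.
    by apply/(sortedP 0) => i ilt; have := dla i ilt; rewrite /=; lia.
  apply/negP => /(nthP 0) [i]; rewrite szla => ilt; rewrite laE //.
  by have := lowX _ ilt; lia.
have core i j T : (forall g, semig S K g -> semig S K (g + T)) ->
    (i, j) \in young la -> hook_length la (i, j) <> T.
  move=> ST uin hT; have [y [e ny]] := hook_length_beta pla uin.
  have ilt : i < n by move: uin; rewrite mem_young szla => /andP [].
  rewrite hT betaE // in e; have [|a1 a2 a3] := memX (nth 0 X i); first by rewrite mem_nth ?szX.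
  have yX : y \in X.
    apply: inX; first by lia.
    have -> : h - y = h - nth 0 X i + T by lia.
    exact: ST.
  have yn : index y X < size la by rewrite szla -szX index_mem.
  by have := ny _ yn; rewrite betaE ?nth_index ?eqxx // -szX index_mem.
have hX : h \in X by apply: inX => //; rewrite subnn; apply: semig0.
have hlt : index h X < n by rewrite -szX index_mem.
have bh : beta la (index h X) = h by rewrite betaE // nth_index.
(* As 0 is not a first-column hook length, [y = 0] gives a cell with hook length exactly [h]. *)
have [|||j [jy je]] := @beta_hook_length la (index h X) 0 pla.
- by rewrite szla.
- by rewrite bh; have [] := memX _ hX.
- by move=> r rn; rewrite betaE -?szla //; have := lowX r; rewrite -szla; lia.
exists la, (index h X, j); split=> //; last by rewrite je bh subn0.
split=> // -[i' j'] uin; split; apply: core uin.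
  exact: semigDl.
exact: semigDr.
Qed.

Lemma is_max_hookP D S K h : 0 < S -> admissible D S K h ->
  (forall h', admissible D S K h' -> h' <= h) -> is_max_hook D S K h.
Proof.
move=> S0 ah mh; split; first exact: admissible_occurs.
by move=> h' /occurs_admissible [h0 le /mh]; apply: leq_trans.
Qed.

(** * Both maxima in terms of the least gap *)

(* [M] is the least upper end of a gap of length at most [d] in the semigroup. *)
Definition least_gap (d s k M : nat) : Prop :=
  [/\ semig s k M, exists g', [/\ semig s k g', g' < M & M <= g' + d]
    & forall g g', semig s k g -> semig s k g' -> g' < g -> g <= g' + d -> M <= g].

Lemma admissible_least_gap d s k M h : least_gap d s k M ->
  admissible d s k h <-> ~ semig s k h /\ h < M.
Proof.
case=> sM [g' [sg' gM Mg]] mM; split=> [[nh sep]|[nh hM]]; split=> //.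
  by rewrite ltnNge; apply/negP => Mh; have := sep _ _ sM sg' gM Mh; lia.
move=> g g1 sg sg1 lt gh; have := mM _ _ sg sg1 lt; lia.
Qed.

Lemma semigM b s k g : semig s k g -> semig (b * s) (b * k) (b * g).
Proof. by case=> m [j [jm ->]]; exists m, j; split=> //; nia. Qed.

Lemma semigM_inv b s k g : semig (b * s) (b * k) g ->
  exists2 g0, semig s k g0 & g = b * g0.
Proof.
by case=> m [j [jm ->]]; exists (m * s + j * k); [exists m, j|nia].
Qed.

(** Scaling by [b] turns a distance [e] into [b * e], and [b * e <= b * d + c] iff [e <= d] because
    [c < b]. So the first close pair ends at [b * M], and [b * M - 1] is no multiple of [b]. *)
Lemma max_hook_mul d s k b c M : 0 < s -> 1 < b -> c < b ->
  least_gap d s k M -> is_max_hook (b * d + c) (b * s) (b * k) (b * M - 1).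
Proof.
move=> s0 b1 cb [sM [g' [sg' gM Mg]] mM]; apply: is_max_hookP; first by nia.
  split=> [/semigM_inv [g0 _ e]|].
    by have [h|h] := leqP M g0; nia.
  move=> g g1 /semigM_inv [g0 sg0 ->] /semigM_inv [g2 sg2 ->] lt le.
  have lt0 : g2 < g0 by nia.
  have gM0 : g0 < M by nia.
  have := mM _ _ sg0 sg2 lt0; have [|h _] := leqP g0 (g2 + d); [lia|nia].
move=> h' [_ sep]; rewrite leqNgt; apply/negP => hM.
have := sep _ _ (semigM b sM) (semigM b sg'); nia.
Qed.

Lemma max_hook_isolated d s k M : 0 < s -> 0 < M -> least_gap d s k M ->
  ~ semig s k (M - 1) -> is_max_hook d s k (M - 1).
Proof.
move=> s0 M0 gM nM; apply: is_max_hookP => //.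
  by apply/(admissible_least_gap _ gM); split=> //; lia.
by move=> h /(admissible_least_gap _ gM) [_]; lia.
Qed.

(** If [M - 2] were in the semigroup too, then [M - 2] and [M - 1] would be a close pair ending
    below [M]. *)
Lemma max_hook_consecutive d s k M : 0 < s -> 0 < d -> 1 < M -> least_gap d s k M ->
  semig s k (M - 1) -> is_max_hook d s k (M - 2).
Proof.
move=> s0 d0 M1 gM pM; apply: is_max_hookP => //.
  apply/(admissible_least_gap _ gM); split=> [M2|]; last by lia.
  by case: gM => _ _ mM; have := mM _ _ pM M2; lia.
move=> h /(admissible_least_gap _ gM) [nh hM].
have [e|] := eqVneq h (M - 1); last by lia.
by rewrite e in nh.
Qed.

(** * Arithmetic of [s_tilde] modulo [k] *)

Lemma mul_inv_mod s k : 1 < k -> coprime s k ->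
  exists q, s * inv_mod (s %% k) k = q * k + 1.
Proof.
move=> k1 csk; have [||_ e] := @inv_modP (s %% k) k; first by lia.
  by rewrite coprime_modl.
rewrite modnMml (modn_small k1) in e.
by exists ((s * inv_mod (s %% k) k) %/ k); rewrite {1}(divn_eq (s * _) k) e.
Qed.

(** Modulo [k], [tau] is [x] times the inverse of [s]; one of [x] and [x - k] is an [l] allowed in
    the minimum, so [s_tilde s k d <= tau %% k]. *)
Lemma s_tilde_le s k d v x tau : 0 < d -> coprime s k -> 0 < x -> x < k ->
    tau * s = v * k + x -> (x <= d) || (k <= x + d) ->
  s_tilde s k d <= tau.
Proof.
move=> d0 csk x0 xk e xd.
have k1 : 1 < k by lia.
have [q hq] := mul_inv_mod k1 csk.
have [|_ le] := @s_tildeP s k d _ d0; first by lia.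
move: le hq; move: (inv_mod _ _) => i le hq.
have tauk : (tau %% k <= tau)%N := leq_mod _ _.
have ei : x * i + k * (v * i) = tau + k * (tau * q).
  have : tau * (s * i) = (v * k + x) * i by rewrite mulnA e.
  by rewrite hq; nia.
have [l [l0 l1 l2 el]] : exists l : int, [/\ l != 0, - d%:Z <= l, l <= d%:Z &
    (l = x%:Z) \/ (l = x%:Z - k%:Z)]%R.
  have [h|h] := leqP x d; [exists (Posz x)|exists (x%:Z - k%:Z)%R]; split; lia.
have := le l l0 l1 l2.
suff -> : ((l * i%:Z)%R %% k)%Z = Posz (tau %% k) by lia.
have [z ->] : exists z : int, (l * i%:Z = z * k%:Z + tau%:Z)%R.
  case: el => ->; [exists (tau%:Z * q%:Z - v%:Z * i%:Z)%R|
    exists (tau%:Z * q%:Z - v%:Z * i%:Z - i%:Z)%R]; nia.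
by rewrite modzMDl modz_nat.
Qed.

(** For the [l] attaining the minimum, [s_tilde s k d * s] is [l] modulo [k]. Since [d < k], [x] is
    [l] if [l] is positive and [l + k] otherwise. *)
Lemma s_tilde_spec s k d : 0 < d -> d < k -> coprime s k ->
  let x := (s %% k * s_tilde s k d) %% k in
  [/\ s_tilde s k d * s = (s_tilde s k d * s) %/ k * k + x, 0 < x, x < k
    & (x <= d) || (k <= x + d)].
Proof.
move=> d0 dk csk x.
have xE : x = (s_tilde s k d * s) %% k by rewrite /x modnMml mulnC.
have k1 : 1 < k by lia.
have [q hq] := mul_inv_mod k1 csk.
have [|[l [l0 l1 l2 el]] _] := @s_tildeP s k d _ d0; first by lia.
have xk : x < k by rewrite ltn_mod; lia.
rewrite {1}(divn_eq (s_tilde s k d * s) k) -xE.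
suff : Posz x = (l %% k)%Z.
  have [lp|lp] : (0 < l \/ l < 0)%R by lia.
    by rewrite modz_small; [split=> //; lia|lia].
  have -> : (l = -1 * k%:Z + (l + k%:Z))%R by lia.
  by rewrite modzMDl modz_small; [split=> //; lia|lia].
rewrite xE -modz_nat PoszM -el modzMml.
have -> : (l * (inv_mod (s %% k) k)%:Z * s%:Z = l * q%:Z * k%:Z + l)%R.
  by move: hq; move: (inv_mod _ _) => i; nia.
by rewrite modzMDl.
Qed.

(* [tau] is the distance between the coefficients of [s] in [g] and [g']. *)
Lemma semig_gap s k d g g' : 0 < s -> 0 < d -> d < k -> coprime s k ->
    semig s k g -> semig s k g' -> g' < g -> g <= g' + d ->
  exists tau v, s_tilde s k d <= tau /\
    (tau * s + g' = v * k + g /\ (v + tau) * s <= g \/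
     tau * s + g = v * k + g' /\ v * (s + k) <= g).
Proof.
move=> s0 d0 dk csk [m [j [jm gE]]] [m' [j' [jm' gE']]] lt le.
have [l lE] : exists l, g = g' + l by exists (g - g'); lia.
have [mm|mm|mm] := ltngtP m m'.
- have e : (m' - m) * s + j' * k + l = j * k by nia.
  have jj : j' < j by nia.
  exists (m' - m), (j - j'); split; last by right; split; nia.
  (* Here [tau * s] is [-l] modulo [k]: the quotient drops by one and the remainder is [k - l]. *)
  by apply: (@s_tilde_le _ _ _ (j - j').-1 (k - l)) => //; nia.
- have e : (m - m') * s + j * k = j' * k + l by nia.
  have jj : j <= j' by nia.
  exists (m - m'), (j' - j); split; last by left; split; nia.
  by apply: (@s_tilde_le _ _ _ (j' - j) l) => //; nia.
(* With equal coefficients of [s], [k] would divide [l], although [0 < l <= d < k]. *)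
have e : j * k = j' * k + l by rewrite mm in gE; lia.
by have [h|h] := leqP j j'; nia.
Qed.

Lemma leq_quo k v u l x : v * k + l <= u * k + x -> x < k -> v <= u.
Proof. by move=> h xk; have [//|uv] := leqP v u; nia. Qed.

(** * Location of the least gap when [d < k] *)

Section CoprimeGap.

Variables s k d t u x : nat.
Hypotheses (s1 : 1 < s) (d0 : 0 < d) (dk : d < k) (csk : coprime s k).
Hypotheses (tE : s_tilde s k d = t) (tsE : t * s = u * k + x).
Hypotheses (x0 : 0 < x) (xk : x < k).

Let t0 : 0 < t.
Proof. by rewrite lt0n; apply: contra_eqN tsE => /eqP ->; lia. Qed.

Let gap g g' : semig s k g -> semig s k g' -> g' < g -> g <= g' + d ->
  exists tau v l, [/\ t <= tau, g = g' + l, 0 < l <= d &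
    (tau * s = v * k + l /\ (v + tau) * s <= g \/
     tau * s + l = v * k /\ v * (s + k) <= g)].
Proof.
move=> sg sg' lt le.
have [|tau [v [ttau H]]] := semig_gap _ d0 dk csk sg sg' lt le; first by lia.
exists tau, v, (g - g'); split; [by rewrite -tE|lia|lia|].
by case: H => -[e h]; [left|right]; split=> //; lia.
Qed.

(** The close pair is [u * (s + k)] and [(u + t) * s], at distance [x]. Any other has [u <= v] and
    [t <= tau] in the first alternative of [gap], and [u < v] in the second, so it ends no lower;
    [M - 1] and [M] can only be close with [v = u], [tau = t], [l = 1]. *)
Lemma least_gap_low : x <= d ->
  least_gap d s k ((u + t) * s) /\ (semig s k ((u + t) * s - 1) <-> x = 1).
Proof.
move=> xd.
have ME : (u + t) * s = u * s + u * k + x by rewrite mulnDl tsE addnA.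
have sM : semig s k ((u + t) * s) by exists (u + t), 0; lia.
have sM' : semig s k (u * s + u * k) by exists u, u.
have low tau v l : t <= tau -> l <= d -> tau * s = v * k + l -> u <= v.
  move=> ttau ld e; apply: (@leq_quo k _ _ x l); last by lia.
  by rewrite -e -tsE leq_mul2r ttau orbT.
have high g tau v l : t <= tau -> tau * s + l = v * k -> v * (s + k) <= g ->
    (u + t) * s < g.
  move=> ttau e vg.
  have uv : u < v.
    have : t * s <= tau * s by rewrite leq_mul2r ttau orbT.
    by move=> h; have [vu|//] := leqP v u; nia.
  have : u.+1 * (s + k) <= v * (s + k) by rewrite leq_mul2r uv orbT.
  by rewrite ME mulSn mulnDr; lia.
split.
  split=> //; first by exists (u * s + u * k); split=> //; lia.
  move=> g g' sg sg' lt le; have [tau [v [l [ttau _ ld]]]] := gap sg sg' lt le.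
  case=> -[e vg]; last exact: ltnW (high _ _ _ _ ttau e vg).
  apply: leq_trans vg; rewrite leq_mul2r leq_add ?orbT //.
  by apply: low ttau _ e; lia.
split=> [sM1|x1]; last by rewrite ME x1 addnK.
have [||tau [v [l [ttau lE ld]]]] := gap sM sM1; [lia|lia|].
case=> -[e vg]; last by have := high _ _ _ _ ttau e vg; lia.
have uv : u <= v by apply: low ttau _ e; lia.
rewrite leq_mul2r in vg.
have [? ?] : v = u /\ tau = t by lia.
by subst v tau; lia.
Qed.

(* If [s <= d] then [t = 1] and [x = s]. *)
Let ds : d < x -> d < s.
Proof.
move=> dx; have [sd|//] := leqP s d.
have := @s_tilde_le s k d 0 s 1 d0 csk; rewrite tE => h.
have t1 : t = 1 by have := t0; lia.
by move: tsE; rewrite t1; nia.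
Qed.

(** The close pair is [(u + t).+1 * s] and [u.+1 * (s + k)], at distance [k - x]. As [l <= d < x],
    the first alternative of [gap] forces both [u < v] and [t < tau], which overshoots since
    [k - x <= d < s]; the second forces [u < v]. *)
Lemma least_gap_high : d < x -> k <= x + d ->
  least_gap d s k (u.+1 * (s + k)) /\ (semig s k (u.+1 * (s + k) - 1) <-> x = k - 1).
Proof.
move=> dx xd; have sd := ds dx.
have ME : u.+1 * (s + k) = (u + t).+1 * s + (k - x).
  by rewrite !mulSn mulnDr mulnDl tsE; lia.
have sM : semig s k (u.+1 * (s + k)) by exists u.+1, u.+1; rewrite mulnDr.
have sM' : semig s k ((u + t).+1 * s) by exists (u + t).+1, 0; lia.
have low g tau v l : t <= tau -> l <= d -> tau * s = v * k + l ->
    (v + tau) * s <= g -> u.+1 * (s + k) < g.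
  move=> ttau ld e vg.
  have le : t * s <= tau * s by rewrite leq_mul2r ttau orbT.
  have uv : u < v by have [vu|//] := leqP v u; nia.
  have tt : t < tau.
    have [t1|//] := leqP tau t; have et : tau = t by lia.
    have : u.+1 * k <= v * k by rewrite leq_mul2r uv orbT.
    by rewrite et in e; rewrite mulSn; lia.
  have : (u + t).+2 * s <= (v + tau) * s by rewrite leq_mul2r; lia.
  by rewrite ME !mulSn; lia.
have high tau v l : t <= tau -> tau * s + l = v * k -> 0 < l -> u < v.
  move=> ttau e l0; have : t * s <= tau * s by rewrite leq_mul2r ttau orbT.
  by move=> h; have [vu|//] := leqP v u; nia.
split.
  split=> //; first by exists ((u + t).+1 * s); split=> //; lia.
  move=> g g' sg sg' lt le; have [tau [v [l [ttau _ ld]]]] := gap sg sg' lt le.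
  case=> -[e vg]; first by apply: ltnW; apply: low ttau _ e vg; lia.
  apply: leq_trans vg; rewrite leq_mul2r (high _ _ _ ttau e) ?orbT //; lia.
split=> [sM1|x1]; last by rewrite ME (_ : k - x = 1) ?addnK //; lia.
have [||tau [v [l [ttau lE ld]]]] := gap sM sM1; [lia|lia|].
case=> -[e vg].
  by have := low _ _ _ _ ttau _ e vg; lia.
have uv : u < v by apply: high ttau e _; lia.
rewrite leq_mul2r in vg.
have ? : v = u.+1 by lia.
(* For [t < tau], [tau * s] would be at least [u * k + x + s], which exceeds [u.+1 * k] because
   [k - x <= d < s]. *)
subst v; have [tt|tt] := leqP tau t; last first.
  have : t.+1 * s <= tau * s by rewrite leq_mul2r tt orbT.
  by rewrite !mulSn in e *; lia.
have ? : tau = t by lia.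
by subst tau; rewrite mulSn in e; lia.
Qed.

End CoprimeGap.

(** * Location of the least gap when [k <= d] *)

Lemma semig_ge s k g : semig s k g -> [\/ g = 0, g = s, g = s + k | 2 * s <= g].
Proof.
case=> -[|[|m]] [j [jm ->]].
- by constructor 1; lia.
- by case: j jm => [|[|]] // _; [constructor 2|constructor 3]; lia.
- by constructor 4; rewrite !mulSn; lia.
Qed.

Lemma least_gap_small s k d : 1 < s -> 0 < k -> s <= d ->
  least_gap d s k s /\ ~ semig s k (s - 1).
Proof.
move=> s1 k0 sd; split; last by move/semig_ge=> []; lia.
split; first by exists 1, 0; lia.
  by exists 0; split; [exact: semig0|lia|lia].
by move=> g g' /semig_ge []; lia.
Qed.

(** Here [k <= d < s], so the semigroup begins [0, s, s + k], the rest being at least [2 * s]; the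
    first close pair is [s] and [s + k]. *)
Lemma least_gap_mid s k d : 0 < k -> k <= d -> d < s ->
  least_gap d s k (s + k) /\ (semig s k (s + k - 1) <-> k = 1).
Proof.
move=> k0 kd ds; have ss : semig s k s by exists 1, 0; lia.
split; last first.
  split=> [/semig_ge []|k1]; [lia|lia|lia|lia|].
  by rewrite (_ : s + k - 1 = s) //; lia.
split; first by exists 1, 1; lia.
  by exists s; split; [|lia|lia].
by move=> g g' /semig_ge [] gE /semig_ge [] gE'; lia.
Qed.

(** * The four cases of the formula *)

Theorem theorem1p2 (s k d b c : nat) :
  2 <= s -> 0 < k -> 0 < d -> coprime s k -> 2 <= b -> c < b ->
  let x := ((s %% k) * s_tilde s k d) %% k in
  exists H Hb : nat,
    [/\ is_max_hook d s k H,
        is_max_hook (b * d + c) (b * s) (b * k) Hb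
      & [/\ k = 1 /\ d < s -> Hb = b * (H + 2) - 1,
            k = 1 /\ s <= d -> Hb = b * (H + 1) - 1,
            d < k /\ (x = 1 \/ (d < x /\ x = k - 1)) -> Hb = b * (H + 2) - 1
          & 1 < k /\ ((1 < x /\ x <= d) \/ (d < x /\ x < k - 1) \/ k <= d) ->
              Hb = b * (H + 1) - 1]].
Proof.
move=> s2 k0 d0 csk b2 cb x.
have s0 : 0 < s by lia.
(* With [M - 1] outside the semigroup, [H = M - 1], so [b * M - 1 = b * (H + 1) - 1]. *)
have far M : least_gap d s k M -> ~ semig s k (M - 1) ->
  exists H Hb, [/\ is_max_hook d s k H,
    is_max_hook (b * d + c) (b * s) (b * k) Hb & Hb = b * (H + 1) - 1].
  move=> gM nM; have M0 : 0 < M by case: gM => _ [g' [_ ? _]] _; lia.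
  exists (M - 1), (b * M - 1); rewrite subnK //.
  by split=> //; [apply: max_hook_isolated|apply: max_hook_mul].
(* With [M - 1] inside, [H = M - 2]; [1 < M] holds because nonzero elements are at least [s]. *)
have near M : least_gap d s k M -> semig s k (M - 1) ->
  exists H Hb, [/\ is_max_hook d s k H,
    is_max_hook (b * d + c) (b * s) (b * k) Hb & Hb = b * (H + 2) - 1].
  move=> gM nM; have M0 : 1 < M.
    by case: (gM) => /semig_ge [] ? [g' [_ ? _]] _; lia.
  exists (M - 2), (b * M - 1); rewrite subnK //.
  by split=> //; [apply: max_hook_consecutive|apply: max_hook_mul].
have [kd|dk] := leqP k d.
  have [sd|ds] := leqP s d.
    have [gM nM] := least_gap_small s2 k0 sd.
    have [H [Hb [mH mHb e]]] := far _ gM nM.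
    by exists H, Hb; split=> //; split; lia.
  have [gM [nM1 nM2]] := least_gap_mid k0 kd ds.
  have [k1|k1] := eqVneq k 1.
    have [H [Hb [mH mHb e]]] := near _ gM (nM2 k1).
    by exists H, Hb; split=> //; split; lia.
  have [|H [Hb [mH mHb e]]] := far _ gM; first by move/nM1; lia.
  by exists H, Hb; split=> //; split; lia.
have [tsE x0 xk xd] := s_tilde_spec d0 dk csk; rewrite -/x in tsE x0 xk xd.
have [xd'|dx] := leqP x d.
  have [gM [nM1 nM2]] := least_gap_low s2 d0 dk csk erefl tsE x0 xk xd'.
  have [x1|x1] := eqVneq x 1.
    have [H [Hb [mH mHb e]]] := near _ gM (nM2 x1).
    by exists H, Hb; split=> //; split; lia.
  have [|H [Hb [mH mHb e]]] := far _ gM; first by move/nM1; lia.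
  by exists H, Hb; split=> //; split; lia.
have [|gM [nM1 nM2]] := least_gap_high s2 d0 dk csk erefl tsE x0 xk dx; first by lia.
(* The value [x = 1] cannot occur here, since [0 < d < x]. *)
have [x1|x1] := eqVneq x (k - 1).
  have [H [Hb [mH mHb e]]] := near _ gM (nM2 x1).
  by exists H, Hb; split=> //; split; lia.
have [|H [Hb [mH mHb e]]] := far _ gM; first by move/nM1; lia.
by exists H, Hb; split=> //; split; lia.
Qed.
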